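(* Let $K$ be a field, $\lambda\in K$, and let $(A,\mu,1,\alpha_A,\beta_A,\psi_A,\omega_A,r)$ be a quasitriangular unitary $\lambda$-infBH-bialgebra over $K$, with comultiplication $\Delta_r$. Let $(M,\gamma,\alpha_M,\beta_M)$ be a left $(A,\mu,\alpha_A,\beta_A)$-module, written $\gamma(a\otimes m)=a\triangleright m$, and let $\psi_M,\omega_M:M\to M$ be linear maps such that $\beta_M\circ\psi_M=\psi_M\circ\beta_M$ and $\psi_M\circ\gamma=\gamma\circ(\psi_A\otimes\psi_M)$. Then $(M,\gamma,\rho,\alpha_M,\beta_M,\psi_M,\omega_M)$ becomes a $\lambda$-infBH-Hopf module over $(A,\mu,\Delta_r,\alpha_A,\beta_A,\psi_A,\omega_A)$ with the coaction $\rho:M\to A\otimes M$ given by $$\rho(m)=-\alpha_A(r^1)\otimes r^2\triangleright\psi_M\beta_M^{-1}(m),\qquad m\in M,$$ where $\beta_M^{-1}$ is the inverse of $\beta_M$ (taken to exist).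
   Context: A BiHom-associative algebra $(A,\mu,\alpha,\beta)$ consists of a vector space $A$ and linear maps $\mu:A\otimes A\to A$ (written $ab$), $\alpha,\beta:A\to A$ with $\alpha\beta=\beta\alpha$, $\alpha(ab)=\alpha(a)\alpha(b)$, $\beta(ab)=\beta(a)\beta(b)$, $\alpha(a)(bc)=(ab)\beta(c)$. It is unitary with unit $1$ if $\alpha(1)=1=\beta(1)$, $a1=\alpha(a)$, $1a=\beta(a)$. A BiHom-coassociative coalgebra $(C,\Delta,\psi,\omega)$ consists of a vector space $C$ and linear maps $\Delta:C\to C\otimes C$ (written $c_1\otimes c_2$), $\psi,\omega:C\to C$ with $\psi\omega=\omega\psi$, $(\psi\otimes\psi)\Delta=\Delta\psi$, $(\omega\otimes\omega)\Delta=\Delta\omega$, $(\Delta\otimes\psi)\Delta=(\omega\otimes\Delta)\Delta$. A $\lambda$-infBH-bialgebra $(A,\mu,\Delta,\alpha,\beta,\psi,\omega)$ is a BiHom-associative algebra $(A,\mu,\alpha,\beta)$ that is also a BiHom-coassociative coalgebra $(A,\Delta,\psi,\omega)$, such that each of $\alpha,\beta$ commutes with each of $\psi,\omega$, $(\alpha\otimes\alpha)\Delta=\Delta\alpha$, $(\beta\otimes\beta)\Delta=\Delta\beta$, $\psi$ and $\omega$ are multiplicative, and $\Delta(ab)=\omega(a)b_1\otimes\beta(b_2)+\alpha(a_1)\otimes a_2\psi(b)+\lambda\,\alpha\omega(a)\otimes\beta\psi(b)$. A quasitriangular unitary $\lambda$-infBH-bialgebra $(A,\mu,1,\alpha,\beta,\psi,\omega,r)$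 consists of a unitary BiHom-associative algebra $(A,\mu,1,\alpha,\beta)$ with $\alpha,\beta$ bijective, linear maps $\psi,\omega:A\to A$ with $\alpha\psi=\psi\alpha$, $\alpha\omega=\omega\alpha$, $\beta\psi=\psi\beta$, $\beta\omega=\omega\beta$, $\psi,\omega$ multiplicative, $\psi(1)=1=\omega(1)$, and an element $r=r^1\otimes r^2\in A\otimes A$ with $(f\otimes f)(r)=r$ for $f\in\{\alpha,\beta,\psi,\omega\}$, such that $r_{13}r_{12}-r_{12}r_{23}+r_{23}r_{13}=\lambda r_{13}$, where (with $\bar r=r$) $r_{12}r_{23}=\alpha(r^1)\otimes r^2\bar r^1\otimes\beta(\bar r^2)$, $r_{13}r_{12}=\omega(r^1)\bar r^1\otimes\beta(\bar r^2)\otimes\alpha\psi(r^2)$, $r_{23}r_{13}=\beta\omega(r^1)\otimes\alpha(\bar r^1)\otimes\bar r^2\psi(r^2)$, $r_{13}=\omega(r^1)\otimes1\otimes\psi(r^2)$. It is regarded as a $\lambda$-infBH-bialgebra $(A,\mu,\Delta_r,\alpha,\beta,\psi,\omega)$ with comultiplication $\Delta_r(a)=\omega\alpha^{-1}(a)r^1\otimes\beta(r^2)-\alpha(r^1)\otimes r^2\psi\beta^{-1}(a)-\lambda(\omega(a)\otimes1)$. A left $(A,\mu,\alpha_A,\beta_A)$-module $(M,\gamma,\alpha_M,\beta_M)$: a vector space $M$ with linear maps $\alpha_M,\beta_M:M\to M$, $\gamma:A\otimes M\to M$ such that $\alpha_M\beta_M=\beta_M\alpha_M$, $\alpha_M(a\triangleright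 m)=\alpha_A(a)\triangleright\alpha_M(m)$, $\beta_M(a\triangleright m)=\beta_A(a)\triangleright\beta_M(m)$, $\alpha_A(a)\triangleright(a'\triangleright m)=(aa')\triangleright\beta_M(m)$. A left $(A,\Delta,\psi_A,\omega_A)$-comodule $(M,\rho,\psi_M,\omega_M)$: linear maps $\psi_M,\omega_M:M\to M$, $\rho:M\to A\otimes M$ (written $\rho(m)=m_{-1}\otimes m_0$) with $\psi_M\omega_M=\omega_M\psi_M$, $\rho\psi_M=(\psi_A\otimes\psi_M)\rho$, $\rho\omega_M=(\omega_A\otimes\omega_M)\rho$, $(\Delta\otimes\psi_M)\rho=(\omega_A\otimes\rho)\rho$. A (left) $\lambda$-infBH-Hopf module $(M,\gamma,\rho,\alpha_M,\beta_M,\psi_M,\omega_M)$ over a $\lambda$-infBH-bialgebra $(A,\mu,\Delta,\alpha_A,\beta_A,\psi_A,\omega_A)$: $(M,\gamma,\alpha_M,\beta_M)$ is a left module, $(M,\rho,\psi_M,\omega_M)$ is a left comodule, any two of $\alpha_M,\beta_M,\psi_M,\omega_M$ commute, and $$(a\triangleright m)_{-1}\otimes(a\triangleright m)_0=\omega_A(a)m_{-1}\otimes\beta_M(m_0)+\alpha_A(a_1)\otimes a_2\triangleright\psi_M(m)+\lambda\,\alpha_A\omega_A(a)\otimes\beta_M\psi_M(m).$$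
   Formalization: Added, as the printed claim fails without such conditions: ψ_A, ω_A commute; α_M, β_M, ψ_M, ω_M commute pairwise (beyond the given β_Mψ_M=ψ_Mβ_M and the module axiom); ω_M∘γ=γ∘(ω_A⊗ω_M); and, if λ≠0, 1▷m=β_M(m). *)

(* Defs.v *)
From HB Require Import structures.
From mathcomp Require Import all_boot all_order all_algebra.
From mathcomp Require Import generic_quotient boolp classical_sets.

Set Implicit Arguments.
Unset Strict Implicit.
Unset Printing Implicit Defensive.

Import GRing.Theory.
Local Open Scope ring_scope.
Local Open Scope quotient_scope.

Definition bilin (K : fieldType) (A B C : lmodType K) (f : A -> B -> C) : Prop :=
  bilinear_for *:%R *:%R f.

(** The tensor product of two vector spaces: finite formal sums of pairs,
    modulo the congruence identifying two formal sums when every bilinear map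
    into every vector space takes the same value on them. This is the quotient
    with the universal property of A (x) B: see [tens_bilin], [tliftE],
    [tlift_linear] and [tensor_ext]. *)
Section Tensor.
Variables (K : fieldType) (A B : lmodType K).

Definition fsum (C : lmodType K) (f : A -> B -> C) (s : seq (A * B)) : C :=
  \sum_(p <- s) f p.1 p.2.

Definition tensor_rel (s t : seq (A * B)) : bool :=
  `[< forall (C : lmodType K) (f : A -> B -> C),
        bilin f -> fsum f s = fsum f t >].

Lemma tensor_rel_refl : reflexive tensor_rel.
Proof. by move=> s; apply/asboolP. Qed.

Lemma tensor_rel_sym : symmetric tensor_rel.
Proof.
by move=> s t; apply/asboolP/asboolP => h C f bf; rewrite (h C f bf).
Qed.

Lemma tensor_rel_trans : transitive tensor_rel.
Proof.
move=> t s u /asboolP h1 /asboolP h2; apply/asboolP => C f bf.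
by rewrite (h1 C f bf) (h2 C f bf).
Qed.

Canonical tensor_equiv :=
  EquivRel tensor_rel tensor_rel_refl tensor_rel_sym tensor_rel_trans.

Definition tensor : Type := {eq_quot tensor_equiv}.

HB.instance Definition _ : EqQuotient _ tensor_equiv tensor :=
  EqQuotient.on tensor.
HB.instance Definition _ := Choice.on tensor.

Definition tens (a : A) (b : B) : tensor := \pi_tensor [:: (a, b)].

(** Well defined on the quotient only when [f] is bilinear, which is the case
    in every use below. *)
Definition tlift (C : lmodType K) (f : A -> B -> C) (t : tensor) : C :=
  fsum f (repr t).

Lemma tlift_pi (C : lmodType K) (f : A -> B -> C) s :
  bilin f -> tlift f (\pi_tensor s) = fsum f s.
Proof.
move=> bf; rewrite /tlift.
have /asboolP/(_ C f bf) // : tensor_rel (repr (\pi_tensor s)) s.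
by apply/eqmodP; rewrite reprK.
Qed.

Lemma tensor_eq (t u : tensor) :
  (forall (C : lmodType K) (f : A -> B -> C), bilin f -> tlift f t = tlift f u)
  -> t = u.
Proof.
by move=> h; rewrite -[t]reprK -[u]reprK; apply/eqmodP/asboolP.
Qed.

Definition tensor_zero : tensor := \pi_tensor [::].
Definition tensor_add (t u : tensor) : tensor :=
  \pi_tensor (repr t ++ repr u).
Definition tensor_scale (k : K) (t : tensor) : tensor :=
  \pi_tensor [seq (k *: p.1, p.2) | p <- repr t].
Definition tensor_opp (t : tensor) : tensor := tensor_scale (- 1) t.

Section LiftOps.
Variables (C : lmodType K) (f : A -> B -> C) (bf : bilin f).

Lemma tlift_zero : tlift f tensor_zero = 0.
Proof. by rewrite tlift_pi // /fsum big_nil. Qed.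

Lemma tlift_add t u : tlift f (tensor_add t u) = tlift f t + tlift f u.
Proof. by rewrite tlift_pi // /fsum big_cat. Qed.

Lemma bilinZl k a b : f (k *: a) b = k *: f a b.
Proof.
have h : linear (f^~ b) by case: bf.
pose g : {linear A -> C} := HB.pack (f^~ b) (GRing.isLinear.Build _ _ _ _ _ h).
exact: (linearZ_LR g).
Qed.

Lemma tlift_scale k t : tlift f (tensor_scale k t) = k *: tlift f t.
Proof.
rewrite tlift_pi // /fsum big_map scaler_sumr.
by apply: eq_bigr => p _; rewrite bilinZl.
Qed.

Lemma tlift_opp t : tlift f (tensor_opp t) = - tlift f t.
Proof. by rewrite tlift_scale scaleN1r. Qed.

End LiftOps.

Fact tensor_addA : associative tensor_add.
Proof. by move=> t u v; apply: tensor_eq => C f bf; rewrite !tlift_add ?addrA. Qed.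

Fact tensor_addC : commutative tensor_add.
Proof. by move=> t u; apply: tensor_eq => C f bf; rewrite !tlift_add // addrC. Qed.

Fact tensor_add0 : left_id tensor_zero tensor_add.
Proof.
by move=> t; apply: tensor_eq => C f bf; rewrite tlift_add // tlift_zero // add0r.
Qed.

Fact tensor_addN : left_inverse tensor_zero tensor_opp tensor_add.
Proof.
move=> t; apply: tensor_eq => C f bf.
by rewrite tlift_add // tlift_opp // tlift_zero // addNr.
Qed.

HB.instance Definition _ :=
  GRing.isZmodule.Build tensor tensor_addA tensor_addC tensor_add0 tensor_addN.

Fact tensor_scaleA a b t :
  tensor_scale a (tensor_scale b t) = tensor_scale (a * b) t.
Proof. by apply: tensor_eq => C f bf; rewrite !tlift_scale // scalerA. Qed.

Fact tensor_scale1 : left_id 1 tensor_scale.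
Proof. by move=> t; apply: tensor_eq => C f bf; rewrite tlift_scale // scale1r. Qed.

Fact tensor_scaleDr : right_distributive tensor_scale +%R.
Proof.
move=> k t u; apply: tensor_eq => C f bf.
by rewrite tlift_scale // !tlift_add // !tlift_scale // scalerDr.
Qed.

Fact tensor_scaleDl t : {morph tensor_scale^~ t : a b / a + b}.
Proof.
move=> a b; apply: tensor_eq => C f bf.
by rewrite tlift_add // !tlift_scale // scalerDl.
Qed.

HB.instance Definition _ :=
  GRing.Zmodule_isLmodule.Build K tensor
    tensor_scaleA tensor_scale1 tensor_scaleDr tensor_scaleDl.

Lemma tlift_linear (C : lmodType K) (f : A -> B -> C) :
  bilin f -> linear (tlift f).
Proof.
move=> bf k t u.
by rewrite [LHS]tlift_add // [X in X + _]tlift_scale.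
Qed.

Lemma tliftE (C : lmodType K) (f : A -> B -> C) a b :
  bilin f -> tlift f (tens a b) = f a b.
Proof. by move=> bf; rewrite tlift_pi // /fsum big_seq1. Qed.

Lemma tens_bilin : bilin tens.
Proof.
split=> [b k a a'|a k b b']; apply: tensor_eq => C f bf /=;
  rewrite (tlift_linear bf) !tliftE //.
- by case: bf => + _ => /(_ b k a a').
- by case: bf => _ /(_ a k b b').
Qed.

Lemma tensorE (t : tensor) : t = \sum_(p <- repr t) tens p.1 p.2.
Proof.
apply: tensor_eq => C f bf.
rewrite [LHS]/tlift /fsum.
elim: (repr t) => [|p s IHs]; first by rewrite !big_nil [RHS]tlift_zero.
by rewrite !big_cons [RHS]tlift_add // tliftE // IHs.
Qed.

Lemma tensor_ext (C : lmodType K) (f g : {linear tensor -> C}) :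
  (forall a b, f (tens a b) = g (tens a b)) -> f =1 g.
Proof.
move=> h t; rewrite [t]tensorE !linear_sum.
by apply: eq_bigr => p _; apply: h.
Qed.

End Tensor.

Notation "A ⊗ B" := (tensor A%type B%type)
  (at level 38, right associativity) : type_scope.
Notation "a ⊗ b" := (tens a b)
  (at level 38, right associativity) : ring_scope.

(** [\sw_(a, b <- t) E] is Sweedler notation: the value at [t] of the linear
    map sending a (x) b to [E]. *)
Notation "\sw_ ( a , b <- t ) E" := (tlift (fun a b => E) t)
  (at level 38, a name, b name, t at level 200, E at level 38,
   format "\sw_ ( a ,  b  <-  t )  E") : ring_scope.

Definition tmap (K : fieldType) (A B C D : lmodType K)
    (f : A -> C) (g : B -> D) (t : A ⊗ B) : C ⊗ D :=
  \sw_(a, b <- t) (f a ⊗ g b).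

Definition tassoc (K : fieldType) (A B C : lmodType K)
    (t : (A ⊗ B) ⊗ C) : A ⊗ (B ⊗ C) :=
  \sw_(u, c <- t) (\sw_(a, b <- u) (a ⊗ (b ⊗ c))).

(** The inverse of a bijective map of vector spaces. *)
Definition linv (K : fieldType) (V : lmodType K) (f : V -> V) (y : V) : V :=
  xget 0 [set x | f x = y]%classic.

Lemma linvK (K : fieldType) (V : lmodType K) (f : V -> V) :
  bijective f -> cancel (linv f) f.
Proof.
by case=> g _ gK y; apply: (@xgetPex _ 0 [set x | f x = y]%classic); exists (g y).
Qed.

Lemma linvKV (K : fieldType) (V : lmodType K) (f : V -> V) :
  bijective f -> cancel f (linv f).
Proof. by move=> bf x; apply: (bij_inj bf); rewrite linvK. Qed.

Section Structures.
Variable K : fieldType.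

Definition mu_multiplicative (A : lmodType K) (mu : A ⊗ A -> A) (f : A -> A) :=
  forall a b, f (mu (a ⊗ b)) = mu (f a ⊗ f b).

Record BiHom_associative_algebra (A : lmodType K) (mu : A ⊗ A -> A)
    (al be : A -> A) : Prop := {
  bha_mu_linear : linear mu;
  bha_al_linear : linear al;
  bha_be_linear : linear be;
  bha_al_be : forall a, al (be a) = be (al a);
  bha_al_mul : mu_multiplicative mu al;
  bha_be_mul : mu_multiplicative mu be;
  bha_assoc : forall a b c,
    mu (al a ⊗ mu (b ⊗ c)) = mu (mu (a ⊗ b) ⊗ be c)
}.

Record BiHom_unit (A : lmodType K) (mu : A ⊗ A -> A) (one : A)
    (al be : A -> A) : Prop := {
  bhu_al : al one = one;
  bhu_be : be one = one;
  bhu_mulr : forall a, mu (a ⊗ one) = al a;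
  bhu_mull : forall a, mu (one ⊗ a) = be a
}.

Record BiHom_coassociative_coalgebra (C : lmodType K) (Delta : C -> C ⊗ C)
    (ps om : C -> C) : Prop := {
  bhc_Delta_linear : linear Delta;
  bhc_ps_linear : linear ps;
  bhc_om_linear : linear om;
  bhc_ps_om : forall c, ps (om c) = om (ps c);
  bhc_ps_Delta : forall c, tmap ps ps (Delta c) = Delta (ps c);
  bhc_om_Delta : forall c, tmap om om (Delta c) = Delta (om c);
  bhc_coassoc : forall c,
    tassoc (tmap Delta ps (Delta c)) = tmap om Delta (Delta c)
}.

Record infBH_bialgebra (lam : K) (A : lmodType K) (mu : A ⊗ A -> A)
    (Delta : A -> A ⊗ A) (al be ps om : A -> A) : Prop := {
  ibh_algebra : BiHom_associative_algebra mu al be;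
  ibh_coalgebra : BiHom_coassociative_coalgebra Delta ps om;
  ibh_al_ps : forall a, al (ps a) = ps (al a);
  ibh_al_om : forall a, al (om a) = om (al a);
  ibh_be_ps : forall a, be (ps a) = ps (be a);
  ibh_be_om : forall a, be (om a) = om (be a);
  ibh_al_Delta : forall a, tmap al al (Delta a) = Delta (al a);
  ibh_be_Delta : forall a, tmap be be (Delta a) = Delta (be a);
  ibh_ps_mul : mu_multiplicative mu ps;
  ibh_om_mul : mu_multiplicative mu om;
  ibh_Delta_mul : forall a b,
    Delta (mu (a ⊗ b)) =
      (\sw_(b1, b2 <- Delta b) (mu (om a ⊗ b1) ⊗ be b2))
      + (\sw_(a1, a2 <- Delta a) (al a1 ⊗ mu (a2 ⊗ ps b)))
      + lam *: (al (om a) ⊗ be (ps b))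
}.

Section Quasitriangular.
Variables (lam : K) (A : lmodType K) (mu : A ⊗ A -> A) (one : A).
Variables (al be ps om : A -> A) (r : A ⊗ A).

Definition r12r23 : A ⊗ (A ⊗ A) :=
  \sw_(r1, r2 <- r) (\sw_(s1, s2 <- r) (al r1 ⊗ (mu (r2 ⊗ s1) ⊗ be s2))).

Definition r13r12 : A ⊗ (A ⊗ A) :=
  \sw_(r1, r2 <- r) (\sw_(s1, s2 <- r) (mu (om r1 ⊗ s1) ⊗ (be s2 ⊗ al (ps r2)))).

Definition r23r13 : A ⊗ (A ⊗ A) :=
  \sw_(r1, r2 <- r) (\sw_(s1, s2 <- r) (be (om r1) ⊗ (al s1 ⊗ mu (s2 ⊗ ps r2)))).

Definition r13 : A ⊗ (A ⊗ A) :=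
  \sw_(r1, r2 <- r) (om r1 ⊗ (one ⊗ ps r2)).

Record quasitriangular_infBH_bialgebra : Prop := {
  qt_algebra : BiHom_associative_algebra mu al be;
  qt_unit : BiHom_unit mu one al be;
  qt_al_bij : bijective al;
  qt_be_bij : bijective be;
  qt_ps_linear : linear ps;
  qt_om_linear : linear om;
  qt_al_ps : forall a, al (ps a) = ps (al a);
  qt_al_om : forall a, al (om a) = om (al a);
  qt_be_ps : forall a, be (ps a) = ps (be a);
  qt_be_om : forall a, be (om a) = om (be a);
  qt_ps_mul : mu_multiplicative mu ps;
  qt_om_mul : mu_multiplicative mu om;
  qt_ps1 : ps one = one;
  qt_om1 : om one = one;
  qt_al_r : tmap al al r = r;
  qt_be_r : tmap be be r = r;
  qt_ps_r : tmap ps ps r = r;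
  qt_om_r : tmap om om r = r;
  qt_eq : r13r12 - r12r23 + r23r13 = lam *: r13
}.

Definition Delta_r (a : A) : A ⊗ A :=
  (\sw_(r1, r2 <- r) (mu (om (linv al a) ⊗ r1) ⊗ be r2))
  - (\sw_(r1, r2 <- r) (al r1 ⊗ mu (r2 ⊗ ps (linv be a))))
  - lam *: (om a ⊗ one).

End Quasitriangular.

Record left_module (A M : lmodType K) (mu : A ⊗ A -> A) (alA beA : A -> A)
    (gam : A ⊗ M -> M) (alM beM : M -> M) : Prop := {
  lm_gam_linear : linear gam;
  lm_al_linear : linear alM;
  lm_be_linear : linear beM;
  lm_al_be : forall m, alM (beM m) = beM (alM m);
  lm_al_gam : forall a m, alM (gam (a ⊗ m)) = gam (alA a ⊗ alM m);
  lm_be_gam : forall a m, beM (gam (a ⊗ m)) = gam (beA a ⊗ beM m);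
  lm_assoc : forall a a' m,
    gam (alA a ⊗ gam (a' ⊗ m)) = gam (mu (a ⊗ a') ⊗ beM m)
}.

Record left_comodule (A M : lmodType K) (Delta : A -> A ⊗ A)
    (psA omA : A -> A) (rho : M -> A ⊗ M) (psM omM : M -> M) : Prop := {
  lc_rho_linear : linear rho;
  lc_ps_linear : linear psM;
  lc_om_linear : linear omM;
  lc_ps_om : forall m, psM (omM m) = omM (psM m);
  lc_rho_ps : forall m, rho (psM m) = tmap psA psM (rho m);
  lc_rho_om : forall m, rho (omM m) = tmap omA omM (rho m);
  lc_coassoc : forall m,
    tassoc (tmap Delta psM (rho m)) = tmap omA rho (rho m)
}.

Record infBH_Hopf_module (lam : K) (A M : lmodType K) (mu : A ⊗ A -> A)
    (Delta : A -> A ⊗ A) (alA beA psA omA : A -> A)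
    (gam : A ⊗ M -> M) (rho : M -> A ⊗ M) (alM beM psM omM : M -> M) : Prop := {
  hm_bialgebra : infBH_bialgebra lam mu Delta alA beA psA omA;
  hm_module : left_module mu alA beA gam alM beM;
  hm_comodule : left_comodule Delta psA omA rho psM omM;
  hm_al_ps : forall m, alM (psM m) = psM (alM m);
  hm_al_om : forall m, alM (omM m) = omM (alM m);
  hm_be_ps : forall m, beM (psM m) = psM (beM m);
  hm_be_om : forall m, beM (omM m) = omM (beM m);
  hm_compat : forall a m,
    rho (gam (a ⊗ m)) =
      (\sw_(m_1, m0 <- rho m) (mu (omA a ⊗ m_1) ⊗ beM m0))
      + (\sw_(a1, a2 <- Delta a) (alA a1 ⊗ gam (a2 ⊗ psM m)))
      + lam *: (alA (omA a) ⊗ beM (psM m))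
}.

Definition rho_r (A M : lmodType K) (alA : A -> A) (r : A ⊗ A)
    (gam : A ⊗ M -> M) (beM psM : M -> M) (m : M) : A ⊗ M :=
  - \sw_(r1, r2 <- r) (alA r1 ⊗ gam (r2 ⊗ psM (linv beM m))).

End Structures.

(* Main.v *)
(** The Yang-Baxter equation is only used through the two identities
    [(Delta_r (x) psi)(r) = - r23 r13] and
    [(omega (x) Delta_r)(r) = r12 r23 - r23 r13 - lam r (x) 1], which follow by
    expanding [Delta_r] and moving [alpha], [beta], [psi], [omega] across [r] by
    invariance. [Delta_r] satisfies the derivation law by BiHom-associativity;
    with that law, the two identities give coassociativity. For the coaction
    [rho], the first identity and the module axiom give
    [(Delta_r (x) psi) rho = (omega (x) rho) rho], and the Hopf compatibility is
    a direct expansion in which the terms containing [r] cancel; unitality of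
    the action is needed only to match the [lam] terms. *)

From HB Require Import structures.
Require Import Defs.
From mathcomp Require Import all_boot all_order all_algebra.
Import GRing.Theory.
Local Open Scope ring_scope.

Set Implicit Arguments.
Unset Strict Implicit.

Lemma commute_cancel (T : Type) (f g h : T -> T) : cancel f g -> cancel g f ->
  (forall a, h (f a) = f (h a)) -> forall a, h (g a) = g (h a).
Proof. by move=> fK gK hf a; apply: (can_inj fK); rewrite -hf !gK. Qed.

(** Flips a commutation hypothesis into the direction in which the sorting rules [normE] and [normM]
    rewrite. *)
Lemma commute_sym (T : Type) (f g : T -> T) :
  (forall a, f (g a) = g (f a)) -> forall a, g (f a) = f (g a).
Proof. by []. Qed.

(** * Linearity of maps built from tensors and Sweedler sums *)

Section LinearMaps.
Variables (K : fieldType).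
Implicit Types U V W : lmodType K.

Lemma lin_id V : linear (fun x : V => x).
Proof. by []. Qed.

Lemma lin_comp U V W (g : {linear V -> W}) (f : U -> V) :
  linear f -> linear (fun x => g (f x)).
Proof. by move=> hf k x y; rewrite hf linearP. Qed.

Lemma lin_tensl U V W (f : U -> V) (c : W) :
  linear f -> linear (fun x => f x ⊗ c).
Proof. by move=> hf k x y; rewrite hf; case: (tens_bilin V W) => + _; apply. Qed.

Lemma lin_tensr U V W (f : U -> W) (c : V) :
  linear f -> linear (fun x => c ⊗ f x).
Proof. by move=> hf k x y; rewrite hf; case: (tens_bilin V W) => _; apply. Qed.

Lemma lin_add U V (f g : U -> V) :
  linear f -> linear g -> linear (fun x => f x + g x).
Proof. by move=> hf hg k x y; rewrite hf hg scalerDr addrACA. Qed.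

Lemma lin_opp U V (f : U -> V) : linear f -> linear (fun x => - f x).
Proof. by move=> hf k x y; rewrite hf opprD scalerN. Qed.

Lemma lin_scale U V c (f : U -> V) : linear f -> linear (fun x => c *: f x).
Proof. by move=> hf k x y; rewrite hf scalerDr !scalerA mulrC. Qed.

Lemma lin_sw_fun U V W V' (t : V ⊗ W) (f : U -> V -> W -> V') :
  (forall a b, linear (fun x => f x a b)) ->
  linear (fun x => \sw_(a, b <- t) (f x a b)).
Proof.
move=> hf k x y; rewrite /tlift /fsum scaler_sumr -big_split /=.
by apply: eq_bigr => p _; rewrite hf.
Qed.

Lemma lin_sw_arg U V W V' (t : U -> V ⊗ W) (f : V -> W -> V') :
  bilin f -> linear t -> linear (fun x => \sw_(a, b <- t x) (f a b)).
Proof. by move=> bf ht k x y; rewrite ht tlift_linear. Qed.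

Lemma bilin_split U V W (f : U -> V -> W) :
  (forall b, linear (fun a => f a b)) -> (forall a, linear (f a)) -> bilin f.
Proof. by move=> *; split. Qed.

(** Curried form of a linear map out of a triple tensor product; identities in [A ⊗ (A ⊗ A)] are
    used below by evaluating an arbitrary such [T] on them. *)
Definition trilin U V W V' (T : U -> V -> W -> V') : Prop :=
  [/\ forall b c, linear (fun a => T a b c),
      forall a c, linear (fun b => T a b c) &
      forall a b, linear (T a b)].

Section Trilinear.
Variables (U V W V' X : lmodType K) (T : U -> V -> W -> V').
Hypothesis T3 : trilin T.

Lemma lin_tri1 (f : X -> U) b c : linear f -> linear (fun x => T (f x) b c).
Proof. by move=> hf k x y; rewrite hf; case: T3 => + _ _; apply. Qed.

Lemma lin_tri2 a (f : X -> V) c : linear f -> linear (fun x => T a (f x) c).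
Proof. by move=> hf k x y; rewrite hf; case: T3 => _ + _; apply. Qed.

Lemma lin_tri3 a b (f : X -> W) : linear f -> linear (fun x => T a b (f x)).
Proof. by move=> hf k x y; rewrite hf; case: T3 => _ _; apply. Qed.

End Trilinear.

(** [linv f] is picked by choice, so its linearity is checked after applying the injective map
    [f]. *)
Lemma linear_linv V (f : {linear V -> V}) : bijective f -> linear (linv f).
Proof.
move=> bf k x y; apply: (bij_inj bf).
by rewrite linvK // linearP !linvK.
Qed.

End LinearMaps.

(** Syntax-directed: it peels off one outer constructor at a time. [lin_comp] only sees bundled
    linear maps, which is why the sections below take the structure maps as [{linear _ -> _}]. *)
Ltac solve_linear := intros; cbn beta; repeat first
  [ exact: lin_id
  | apply: lin_comp
  | apply: lin_tensl
  | apply: lin_tensr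
  | apply: lin_add
  | apply: lin_opp
  | apply: lin_scale
  | assumption
  | match goal with H : trilin _ |- linear _ =>
      first [apply: (lin_tri1 H) | apply: (lin_tri2 H) | apply: (lin_tri3 H)] end
  | apply: bilin_split => ? /=
  | apply: lin_sw_fun => ? ? /=
  | apply: lin_sw_arg ].
Ltac solve_bilin := apply: bilin_split; solve_linear.
Ltac solve_trilin := split; solve_linear.

(** * Calculus of Sweedler sums *)

Section Sweedler.
Variables (K : fieldType).
Implicit Types U V W X Y : lmodType K.

(** From here to [exchange_sw] the tensor [t] is fixed, so each side is a finite sum over the same
    representative [repr t]. Bilinearity enters only with the lemmas that change the tensor, where
    representatives change too. *)
Lemma eq_sw U V X (t : U ⊗ V) (f g : U -> V -> X) :
  (forall a b, f a b = g a b) ->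
  \sw_(a, b <- t) (f a b) = \sw_(a, b <- t) (g a b).
Proof. by move=> h; apply: eq_bigr. Qed.

Lemma lin_swE U V X Y (g : X -> Y) (t : U ⊗ V) (f : U -> V -> X)
  (hg : linear g) :
  g (\sw_(a, b <- t) (f a b)) = \sw_(a, b <- t) (g (f a b)).
Proof.
pose g' : {linear X -> Y} := HB.pack g (GRing.isLinear.Build _ _ _ _ _ hg).
exact: (linear_sum g').
Qed.

Lemma swD U V X (t : U ⊗ V) (f g : U -> V -> X) :
  \sw_(a, b <- t) (f a b + g a b)
  = \sw_(a, b <- t) (f a b) + \sw_(a, b <- t) (g a b).
Proof. exact: big_split. Qed.

Lemma swN U V X (t : U ⊗ V) (f : U -> V -> X) :
  \sw_(a, b <- t) (- f a b) = - \sw_(a, b <- t) (f a b).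
Proof. exact: sumrN. Qed.

Lemma swZ U V X k (t : U ⊗ V) (f : U -> V -> X) :
  \sw_(a, b <- t) (k *: f a b) = k *: \sw_(a, b <- t) (f a b).
Proof. by rewrite /tlift /fsum scaler_sumr. Qed.

Lemma exchange_sw U V W X Y (t : U ⊗ V) (u : W ⊗ X) (f : U -> V -> W -> X -> Y) :
  \sw_(a, b <- t) (\sw_(c, d <- u) (f a b c d))
  = \sw_(c, d <- u) (\sw_(a, b <- t) (f a b c d)).
Proof. exact: exchange_big. Qed.

Section Linear.
Variables (U V X : lmodType K) (f : U -> V -> X) (bf : bilin f).

Lemma sw_tens a b : \sw_(x, y <- a ⊗ b) (f x y) = f a b.
Proof. exact: tliftE. Qed.

Lemma sw_add t u : \sw_(x, y <- t + u) (f x y)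
  = \sw_(x, y <- t) (f x y) + \sw_(x, y <- u) (f x y).
Proof. exact: tlift_add. Qed.

Lemma sw_opp t : \sw_(x, y <- - t) (f x y) = - \sw_(x, y <- t) (f x y).
Proof. exact: tlift_opp. Qed.

Lemma sw_scale k t : \sw_(x, y <- k *: t) (f x y) = k *: \sw_(x, y <- t) (f x y).
Proof. exact: tlift_scale. Qed.

Lemma sw_sw W Y (t : W ⊗ Y) (g : W -> Y -> U ⊗ V) :
  \sw_(x, y <- \sw_(c, d <- t) (g c d)) (f x y)
  = \sw_(c, d <- t) (\sw_(x, y <- g c d) (f x y)).
Proof. by rewrite [LHS]lin_swE //; apply: tlift_linear. Qed.

End Linear.

Lemma tens_sw U V W (c : W) (t : U ⊗ V) :
  c ⊗ t = \sw_(a, b <- t) (c ⊗ (a ⊗ b)).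
Proof. by rewrite {1}[t]tensorE [LHS](lin_swE t (g := tens c)) //; solve_linear. Qed.

Section Tmap.
Variables (U V W X Y : lmodType K) (g : {linear U -> W}) (h : {linear V -> X}).

Lemma sw_tmap (f : W -> X -> Y) t : bilin f ->
  \sw_(a, b <- tmap g h t) (f a b) = \sw_(a, b <- t) (f (g a) (h b)).
Proof. by move=> bf; rewrite sw_sw //; apply: eq_sw => a b; rewrite sw_tens. Qed.

Lemma tmap_tens a b : tmap g h (a ⊗ b) = g a ⊗ h b.
Proof. by rewrite /tmap sw_tens //; solve_bilin. Qed.

End Tmap.
End Sweedler.

(** Cancels opposite terms in an equation between sums; every atom must occur
    at most once with each sign after moving everything to one side. *)
Ltac zmod_cancel :=
  apply: subr0_eq; rewrite -[LHS]add0r ?(opprD, opprK, addrA);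
  repeat match goal with |- context [(- ?x)%R] =>
    rewrite ?(addrAC _ x) ?(addrAC _ (- x)) addrK end;
  reflexivity.

(** * The bialgebra structure given by [r] *)

Section Bialgebra.
Variables (K : fieldType) (lam : K) (A : lmodType K) (mu : {linear (A ⊗ A)%type -> A}).
Variables (one : A) (al be ps om ia ib : {linear A -> A}) (r : A ⊗ A).
Hypothesis hA : quasitriangular_infBH_bialgebra lam mu one al be ps om r.
Hypothesis ps_om : forall a, ps (om a) = om (ps a).
Hypotheses (alK : cancel al ia) (iaK : cancel ia al).
Hypotheses (beK : cancel be ib) (ibK : cancel ib be).

Local Notation "a ∙ b" := (mu (a ⊗ b)) (at level 40, left associativity).

Let hassoc := qt_algebra hA.
Let hunit := qt_unit hA.
Let alM := bha_al_mul hassoc : forall a b, al (a ∙ b) = al a ∙ al b.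
Let beM := bha_be_mul hassoc : forall a b, be (a ∙ b) = be a ∙ be b.
Let psM := qt_ps_mul hA : forall a b, ps (a ∙ b) = ps a ∙ ps b.
Let omM := qt_om_mul hA : forall a b, om (a ∙ b) = om a ∙ om b.
Let mulA := bha_assoc hassoc : forall a b c, al a ∙ (b ∙ c) = (a ∙ b) ∙ be c.

Let be_al := commute_sym (bha_al_be hassoc).
Let om_al := commute_sym (qt_al_om hA).
Let ps_al := commute_sym (qt_al_ps hA).
Let om_be := commute_sym (qt_be_om hA).
Let ps_be := commute_sym (qt_be_ps hA).
Let be_ia := commute_cancel alK iaK be_al.
Let om_ia := commute_cancel alK iaK om_al.
Let ps_ia := commute_cancel alK iaK ps_al.
Let om_ib := commute_cancel beK ibK om_be.
Let ps_ib := commute_cancel beK ibK ps_be.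
Let ib_al := commute_sym (commute_cancel beK ibK (bha_al_be hassoc)).
Let ib_ia := commute_cancel alK iaK ib_al.

Let iaM a b : ia (a ∙ b) = ia a ∙ ia b.
Proof. by apply: (can_inj alK); rewrite alM !iaK. Qed.
Let ibM a b : ib (a ∙ b) = ib a ∙ ib b.
Proof. by apply: (can_inj beK); rewrite beM !ibK. Qed.

(* Words in the commuting maps are sorted as al, ia, be, ib, om, ps from the
   outside in. *)
Let normE := (alM, beM, psM, omM, iaM, ibM, alK, iaK, beK, ibK, be_al, om_al,
  ps_al, om_be, ps_be, be_ia, om_ia, ps_ia, om_ib, ps_ib, ib_al, ib_ia, ps_om).
Let unitE := (bhu_al hunit, bhu_be hunit, qt_ps1 hA, qt_om1 hA,
  bhu_mulr hunit, bhu_mull hunit).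

(** Read from right to left, it inserts a structure map on both legs of [r] at once. This is how
    inverses such as [ia] and [ib] get cancelled and how the twists demanded by BiHom-associativity
    are supplied. *)
Lemma sw_invariant (U V : lmodType K) (f : {linear U -> U}) (g : {linear V -> V})
  (t : U ⊗ V) (T : lmodType K) (F : U -> V -> T) :
  tmap f g t = t -> bilin F ->
  \sw_(a, b <- t) (F (f a) (g b)) = \sw_(a, b <- t) (F a b).
Proof. by move=> {2}<- bF; rewrite sw_tmap. Qed.

Let sw_al (T : lmodType K) (F : A -> A -> T) := sw_invariant (F := F) (qt_al_r hA).
Let sw_be (T : lmodType K) (F : A -> A -> T) := sw_invariant (F := F) (qt_be_r hA).
Let sw_ps (T : lmodType K) (F : A -> A -> T) := sw_invariant (F := F) (qt_ps_r hA).
Let sw_om (T : lmodType K) (F : A -> A -> T) := sw_invariant (F := F) (qt_om_r hA).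

Definition sw3 (V : lmodType K) (T : A -> A -> A -> V) (t : A ⊗ (A ⊗ A)) : V :=
  \sw_(a, u <- t) (\sw_(b, c <- u) (T a b c)).

Section SW3.
Variables (V : lmodType K) (T : A -> A -> A -> V).
Hypothesis T3 : trilin T.

Lemma sw3_linear : linear (sw3 T).
Proof. by apply: tlift_linear; solve_bilin. Qed.

Lemma sw3_tens a b c : sw3 T (a ⊗ (b ⊗ c)) = T a b c.
Proof. by rewrite /sw3 !sw_tens //; solve_bilin. Qed.

(** The Yang-Baxter equation after applying the linear map [sw3 T] that [T] induces on the triple
    tensor product. *)
Lemma sw_qt_eq :
  \sw_(r1, r2 <- r) (\sw_(s1, s2 <- r) (T (om r1 ∙ s1) (be s2) (al (ps r2))))
  - \sw_(r1, r2 <- r) (\sw_(s1, s2 <- r) (T (al r1) (r2 ∙ s1) (be s2)))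
  + \sw_(r1, r2 <- r) (\sw_(s1, s2 <- r) (T (be (om r1)) (al s1) (s2 ∙ ps r2)))
  = lam *: \sw_(r1, r2 <- r) (T (om r1) one (ps r2)).
Proof.
pose g : {linear _ -> V} := HB.pack (sw3 T) (GRing.isLinear.Build _ _ _ _ _ sw3_linear).
have := congr1 g (qt_eq hA); rewrite linearD linearB linearZ_LR /=.
rewrite /r12r23 /r13r12 /r23r13 /r13 !(lin_swE _ _ sw3_linear).
have E (F G H : A -> A -> A -> A -> A) :
  \sw_(r1, r2 <- r) (sw3 T (\sw_(s1, s2 <- r)
    (F r1 r2 s1 s2 ⊗ (G r1 r2 s1 s2 ⊗ H r1 r2 s1 s2))))
  = \sw_(r1, r2 <- r) (\sw_(s1, s2 <- r)
    (T (F r1 r2 s1 s2) (G r1 r2 s1 s2) (H r1 r2 s1 s2))).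
  apply: eq_sw => a b; rewrite (lin_swE _ _ sw3_linear).
  by apply: eq_sw => c d; rewrite sw3_tens.
rewrite !E => ->; congr (_ *: _).
by apply: eq_sw => a b; rewrite sw3_tens.
Qed.

End SW3.

(** [Delta_r], with the inverses of [al] and [be] as parameters so that they can
    be bundled as linear maps. *)
Definition Del (a : A) : A ⊗ A :=
  (\sw_(r1, r2 <- r) ((om (ia a) ∙ r1) ⊗ be r2))
  - (\sw_(r1, r2 <- r) (al r1 ⊗ (r2 ∙ ps (ib a))))
  - lam *: (om a ⊗ one).

Lemma Del_linear : linear Del.
Proof. by rewrite /Del; solve_linear. Qed.

Lemma sw_Del (V : lmodType K) (F : A -> A -> V) a : bilin F ->
  \sw_(x, y <- Del a) (F x y) =
    \sw_(r1, r2 <- r) (F (om (ia a) ∙ r1) (be r2))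
    - \sw_(r1, r2 <- r) (F (al r1) (r2 ∙ ps (ib a)))
    - lam *: F (om a) one.
Proof.
move=> bF; rewrite /Del !sw_add // !sw_opp // sw_scale // !sw_sw // sw_tens //.
by congr (_ - _ - _); apply: eq_sw => x y; rewrite sw_tens.
Qed.

(** Invariance of [r] inserts [f] on both legs, and multiplicativity then pulls it out of the
    products. One statement serves [al], [be], [ps] and [om]. *)
Lemma Del_commute (f : {linear A -> A}) :
  mu_multiplicative mu f -> f one = one -> tmap f f r = r ->
  (forall a, al (f a) = f (al a)) -> (forall a, be (f a) = f (be a)) ->
  (forall a, om (f a) = f (om a)) -> (forall a, ps (f a) = f (ps a)) ->
  forall a, tmap f f (Del a) = Del (f a).
Proof.
move=> fM f1 fr fal fbe fom fps a.
have ia_f x : ia (f x) = f (ia x) by apply: commute_sym (commute_cancel alK iaK _) x.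
have ib_f x : ib (f x) = f (ib x) by apply: commute_sym (commute_cancel beK ibK _) x.
rewrite /tmap sw_Del; last by solve_bilin.
rewrite /Del f1 ia_f ib_f !fom !fps.
congr (_ - _ - _).
  rewrite -(sw_invariant (F := fun a1 a2 => (f (om (ia a)) ∙ a1) ⊗ be a2) fr);
    last by solve_bilin.
  by apply: eq_sw => x y; rewrite fM fbe.
rewrite -(sw_invariant (F := fun a1 a2 => al a1 ⊗ (a2 ∙ f (ps (ib a)))) fr);
  last by solve_bilin.
by apply: eq_sw => x y; rewrite fM fal.
Qed.

Lemma Del_mul a b :
  Del (a ∙ b) =
    (\sw_(b1, b2 <- Del b) ((om a ∙ b1) ⊗ be b2))
    + (\sw_(a1, a2 <- Del a) (al a1 ⊗ (a2 ∙ ps b)))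
    + lam *: (al (om a) ⊗ be (ps b)).
Proof.
rewrite !sw_Del; try by solve_bilin.
have -> : \sw_(r1, r2 <- r) ((om a ∙ (om (ia b) ∙ r1)) ⊗ be (be r2))
  = \sw_(r1, r2 <- r) ((om (ia (a ∙ b)) ∙ r1) ⊗ be r2).
  rewrite -[RHS](sw_be (F := fun r1 r2 => (om (ia (a ∙ b)) ∙ r1) ⊗ be r2));
    last by solve_bilin.
  by apply: eq_sw => x y; rewrite !normE -mulA !normE.
have -> : \sw_(r1, r2 <- r) (al (al r1) ⊗ ((r2 ∙ ps (ib a)) ∙ ps b))
  = \sw_(r1, r2 <- r) (al r1 ⊗ (r2 ∙ ps (ib (a ∙ b)))).
  rewrite -[RHS](sw_al (F := fun r1 r2 => al r1 ⊗ (r2 ∙ ps (ib (a ∙ b)))));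
    last by solve_bilin.
  by apply: eq_sw => x y; rewrite !normE mulA !normE.
(* The mixed terms of the two sums agree and have opposite signs. The [lam] terms cancel likewise
   once [one ∙ ps b] becomes [be (ps b)], leaving only [- lam *: (om (a ∙ b) ⊗ one)]. *)
have -> : \sw_(r1, r2 <- r) (al (om (ia a) ∙ r1) ⊗ (be r2 ∙ ps b))
  = \sw_(r1, r2 <- r) ((om a ∙ al r1) ⊗ be (r2 ∙ ps (ib b))).
  by apply: eq_sw => x y; rewrite !normE.
rewrite /Del !normE !unitE.
by zmod_cancel.
Qed.

(** Bundling [Del] lets [solve_linear] go through nested Sweedler sums over it. *)
HB.instance Definition _ := GRing.isLinear.Build K A (A ⊗ A)%type _ Del Del_linear.

Lemma sw_Del_mul (V : lmodType K) (F : A -> A -> V) a b : bilin F ->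
  \sw_(x, y <- Del (a ∙ b)) (F x y) =
    \sw_(b1, b2 <- Del b) (F (om a ∙ b1) (be b2))
    + \sw_(a1, a2 <- Del a) (F (al a1) (a2 ∙ ps b))
    + lam *: F (al (om a)) (be (ps b)).
Proof.
move=> bF; rewrite Del_mul 2!(sw_add bF) (sw_scale bF) 2!(sw_sw bF) sw_tens //.
by congr (_ + _ + _); apply: eq_sw => x y; rewrite sw_tens.
Qed.

Lemma sw_Del_al (V : lmodType K) (F : A -> A -> V) a : bilin F ->
  \sw_(x, y <- Del (al a)) (F x y) = \sw_(x, y <- Del a) (F (al x) (al y)).
Proof.
by move=> bF; rewrite -Del_commute ?sw_tmap //; case: hA => _ [].
Qed.

Lemma sw_Del_be (V : lmodType K) (F : A -> A -> V) a : bilin F ->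
  \sw_(x, y <- Del (be a)) (F x y) = \sw_(x, y <- Del a) (F (be x) (be y)).
Proof.
by move=> bF; rewrite -Del_commute ?sw_tmap //; case: hA => _ [].
Qed.

(** * Applying the comultiplication to one leg of [r] *)

Section SWDelta.
Variables (V : lmodType K) (T : A -> A -> A -> V).
Hypothesis T3 : trilin T.

(** After moving [al] and [be] across the outer [r], the three terms of [Del r1] are those of
    [r13r12 - r12r23 - lam *: r13], and the Yang-Baxter equation turns this into [- r23r13]. *)
Lemma sw_r_Del_l :
  \sw_(r1, r2 <- r) (\sw_(x, y <- Del r1) (T x y (ps r2)))
  = - \sw_(r1, r2 <- r) (\sw_(s1, s2 <- r) (T (be (om r1)) (al s1) (s2 ∙ ps r2))).
Proof.
transitivity (
  \sw_(r1, r2 <- r) (\sw_(s1, s2 <- r) (T (om (ia r1) ∙ s1) (be s2) (ps r2)))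
  - \sw_(r1, r2 <- r) (\sw_(s1, s2 <- r) (T (al s1) (s2 ∙ ps (ib r1)) (ps r2)))
  - lam *: \sw_(r1, r2 <- r) (T (om r1) one (ps r2))).
  rewrite -swZ -!swN -!swD; apply: eq_sw => a b.
  by rewrite sw_Del //; solve_bilin.
rewrite -(sw_al (F := fun r1 r2 =>
  \sw_(s1, s2 <- r) (T (om (ia r1) ∙ s1) (be s2) (ps r2)))); last by solve_bilin.
rewrite -(sw_be (F := fun r1 r2 =>
  \sw_(s1, s2 <- r) (T (al s1) (s2 ∙ ps (ib r1)) (ps r2)))); last by solve_bilin.
have -> : \sw_(r1, r2 <- r) (\sw_(s1, s2 <- r)
    (T (al s1) (s2 ∙ ps (ib (be r1))) (ps (be r2))))
  = \sw_(r1, r2 <- r) (\sw_(s1, s2 <- r) (T (al r1) (r2 ∙ s1) (be s2))).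
  rewrite [RHS]exchange_sw -[RHS]sw_ps; last by solve_bilin.
  by do 2!apply: eq_sw => ? ?; rewrite !normE.
have -> : \sw_(r1, r2 <- r) (\sw_(s1, s2 <- r)
    (T (om (ia (al r1)) ∙ s1) (be s2) (ps (al r2))))
  = \sw_(r1, r2 <- r) (\sw_(s1, s2 <- r) (T (om r1 ∙ s1) (be s2) (al (ps r2)))).
  by do 2!apply: eq_sw => ? ?; rewrite !normE.
rewrite -(sw_qt_eq T3); zmod_cancel.
Qed.

(** Term by term: inserting [al] or [be] on the outer [r] cancels [ia] or [ib], and invariance under
    [om] matches the remaining twists. *)
Lemma sw_r_Del_r :
  \sw_(r1, r2 <- r) (\sw_(x, y <- Del r2) (T (om r1) x y))
  = \sw_(r1, r2 <- r) (\sw_(s1, s2 <- r) (T (al r1) (r2 ∙ s1) (be s2)))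
  - \sw_(r1, r2 <- r) (\sw_(s1, s2 <- r) (T (be (om r1)) (al s1) (s2 ∙ ps r2)))
  - lam *: \sw_(r1, r2 <- r) (T r1 r2 one).
Proof.
transitivity (
  \sw_(r1, r2 <- r) (\sw_(s1, s2 <- r) (T (om r1) (om (ia r2) ∙ s1) (be s2)))
  - \sw_(r1, r2 <- r) (\sw_(s1, s2 <- r) (T (om r1) (al s1) (s2 ∙ ps (ib r2))))
  - lam *: \sw_(r1, r2 <- r) (T (om r1) (om r2) one)).
  rewrite -swZ -!swN -!swD; apply: eq_sw => a b.
  by rewrite sw_Del //; solve_bilin.
rewrite (sw_om (F := fun r1 r2 => T r1 r2 one)); last by solve_bilin.
rewrite -(sw_be (F := fun r1 r2 =>
  \sw_(s1, s2 <- r) (T (om r1) (al s1) (s2 ∙ ps (ib r2))))); last by solve_bilin.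
rewrite -(sw_al (F := fun r1 r2 =>
  \sw_(s1, s2 <- r) (T (om r1) (om (ia r2) ∙ s1) (be s2)))); last by solve_bilin.
congr (_ - _ - _).
  rewrite -[RHS]sw_om; last by solve_bilin.
  by do 2!apply: eq_sw => ? ?; rewrite !normE.
by do 2!apply: eq_sw => ? ?; rewrite !normE.
Qed.

End SWDelta.

(** Expanding the outer [Del a] splits each side into three terms, evaluated in [L1], [L2], [L3] and
    [R1], [R2], [R3]. The derivation law reduces [Del] of a product to [Del] of its factors; where
    the factor is a leg of [r], [sw_r_Del_l] or [sw_r_Del_r] applies. *)
Lemma Del_coassoc a :
  tassoc (tmap Del ps (Del a)) = tmap om Del (Del a).
Proof.
have -> : tassoc (tmap Del ps (Del a)) =
  \sw_(a1, a2 <- Del a) (\sw_(x, y <- Del a1) (x ⊗ (y ⊗ ps a2))).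
  rewrite /tassoc /tmap sw_sw; last by solve_bilin.
  by apply: eq_sw => a1 a2; rewrite sw_tens //; solve_bilin.
have -> : tmap om Del (Del a) =
  \sw_(a1, a2 <- Del a) (\sw_(x, y <- Del a2) (om a1 ⊗ (x ⊗ y))).
  by apply: eq_sw => a1 a2; rewrite tens_sw.
(* [x] and [y] are the factors that [Del a] multiplies into the legs of [r]. [z] arises from
   expanding [Del x] on the left and, as [om (ia y)], from expanding [Del y] on the right, so that
   [P3] is common to both sides. *)
set x := om (ia a); set y := ps (ib a); set z := ps (ib x).
(* Both sides equal [- P1 + P2 - P3 + P4 - lam (Q1 - Q2 - lam Q3)]. *)
pose P1 := \sw_(r1, r2 <- r) (\sw_(s1, s2 <- r)
  ((om x ∙ be (om r1)) ⊗ (be (al s1) ⊗ be (s2 ∙ ps r2)))).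
pose P2 := \sw_(r1, r2 <- r) (\sw_(s1, s2 <- r)
  ((om x ∙ al r1) ⊗ (be (r2 ∙ s1) ⊗ be (be s2)))).
pose P3 := \sw_(r1, r2 <- r) (\sw_(s1, s2 <- r)
  (al (al r1) ⊗ ((al r2 ∙ (z ∙ s1)) ⊗ be (be s2)))).
pose P4 := \sw_(r1, r2 <- r) (\sw_(s1, s2 <- r)
  (al (be (om r1)) ⊗ (al (al s1) ⊗ ((s2 ∙ ps r2) ∙ ps y)))).
pose Q1 := \sw_(r1, r2 <- r) ((om x ∙ r1) ⊗ (be r2 ⊗ one)).
pose Q2 := \sw_(r1, r2 <- r) (al r1 ⊗ ((r2 ∙ om y) ⊗ one)).
pose Q3 := om (om a) ⊗ (one ⊗ one).
have L1 : \sw_(r1, r2 <- r) (\sw_(u, v <- Del (x ∙ r1)) (u ⊗ (v ⊗ ps (be r2))))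
    = - P1 + P2 - P3.
  transitivity (
    \sw_(r1, r2 <- r) (\sw_(u, v <- Del r1)
       ((om x ∙ u) ⊗ (be v ⊗ be (ps r2))))
    + \sw_(r1, r2 <- r) (\sw_(u, v <- Del x)
       (al u ⊗ ((v ∙ ps r1) ⊗ be (ps r2))))
    + lam *: \sw_(r1, r2 <- r) (al (om x) ⊗ (be (ps r1) ⊗ be (ps r2)))).
    rewrite -swZ -!swD; apply: eq_sw => r1 r2.
    by rewrite sw_Del_mul; [rewrite !normE | solve_bilin].
  rewrite (sw_r_Del_l (T := fun u v w => (om x ∙ u) ⊗ (be v ⊗ be w)));
    last by solve_trilin.
  rewrite -/P1 -!addrA; congr (_ + _).
  rewrite (sw_ps (F := fun r1 r2 => \sw_(u, v <- Del x)
       (al u ⊗ ((v ∙ r1) ⊗ be r2)))); last by solve_bilin.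
  rewrite (sw_ps (F := fun r1 r2 => al (om x) ⊗ (be r1 ⊗ be r2)));
    last by solve_bilin.
  (* The unit term of [Del x] contributes [one ∙ r1], that is [be r1], and so cancels the [lam] term
     of the derivation law. *)
  transitivity (
    \sw_(r1, r2 <- r) (\sw_(s1, s2 <- r)
       ((om x ∙ al s1) ⊗ ((be s2 ∙ r1) ⊗ be r2)))
    - \sw_(r1, r2 <- r) (\sw_(s1, s2 <- r)
       (al (al s1) ⊗ (((s2 ∙ z) ∙ r1) ⊗ be r2)))
    - lam *: \sw_(r1, r2 <- r) (al (om x) ⊗ (be r1 ⊗ be r2))
    + lam *: \sw_(r1, r2 <- r) (al (om x) ⊗ (be r1 ⊗ be r2))).
    congr (_ + _); rewrite -swZ -!swN -!swD; apply: eq_sw => r1 r2.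
    rewrite sw_Del; last by solve_bilin.
    congr (_ - _ - _); last by rewrite unitE.
    by apply: eq_sw => s1 s2; rewrite !normE.
  rewrite subrK; congr (_ - _).
    rewrite [LHS]exchange_sw; apply: eq_sw => s1 s2.
    rewrite -[LHS]sw_be; last by solve_bilin.
    by apply: eq_sw => r1 r2; rewrite !normE.
  (* Inserting [be] on the inner [r] produces the factor [be r1] that BiHom-associativity asks
     for. *)
  rewrite [LHS]exchange_sw; apply: eq_sw => s1 s2.
  rewrite -[LHS]sw_be; last by solve_bilin.
  by apply: eq_sw => r1 r2; rewrite mulA.
have L2 : \sw_(r1, r2 <- r) (\sw_(u, v <- Del (al r1)) (u ⊗ (v ⊗ ps (r2 ∙ y))))
    = - P4.
  rewrite -(sw_r_Del_l (T := fun u v w => al u ⊗ (al v ⊗ (w ∙ ps y))));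
    last by solve_trilin.
  by apply: eq_sw => r1 r2; rewrite sw_Del_al; [rewrite !normE | solve_bilin].
have L3 : \sw_(u, v <- Del (om a)) (u ⊗ (v ⊗ ps one)) = Q1 - Q2 - lam *: Q3.
  rewrite sw_Del; last by solve_bilin.
  by rewrite !unitE /Q1 /Q2 /x /y !normE.
have R1 : \sw_(r1, r2 <- r) (\sw_(u, v <- Del (be r2)) (om (x ∙ r1) ⊗ (u ⊗ v)))
    = P2 - P1 - lam *: Q1.
  (* Writing [one] as [be one] brings [Q1] to the shape [T r1 r2 one] for the [T] used next. *)
  rewrite /Q1 -[one](bhu_be hunit).
  rewrite -(sw_r_Del_r (T := fun u v w => (om x ∙ u) ⊗ (be v ⊗ be w)));
    last by solve_trilin.
  by apply: eq_sw => r1 r2; rewrite sw_Del_be; [rewrite !normE | solve_bilin].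
have R2 : \sw_(r1, r2 <- r) (\sw_(u, v <- Del (r2 ∙ y)) (om (al r1) ⊗ (u ⊗ v)))
    = P3 - P4 - lam *: Q2.
  transitivity (
    \sw_(r1, r2 <- r) (\sw_(u, v <- Del y)
       (al (om r1) ⊗ ((om r2 ∙ u) ⊗ be v)))
    + \sw_(r1, r2 <- r) (\sw_(u, v <- Del r2)
       (al (om r1) ⊗ (al u ⊗ (v ∙ ps y))))
    + lam *: \sw_(r1, r2 <- r) (al (om r1) ⊗ (al (om r2) ⊗ be (ps y)))).
    rewrite -swZ -!swD; apply: eq_sw => r1 r2.
    by rewrite sw_Del_mul; [rewrite !normE | solve_bilin].
  rewrite (sw_r_Del_r (T := fun u v w => al u ⊗ (al v ⊗ (w ∙ ps y))));
    last by solve_trilin.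
  rewrite (sw_om (F := fun r1 r2 => \sw_(u, v <- Del y)
       (al r1 ⊗ ((r2 ∙ u) ⊗ be v)))); last by solve_bilin.
  rewrite (sw_om (F := fun r1 r2 => al r1 ⊗ (al r2 ⊗ be (ps y))));
    last by solve_bilin.
  (* [S] is the mixed term: negative in the expansion of [Del y], positive in that of [Del r2]. *)
  pose S := \sw_(r1, r2 <- r) (\sw_(s1, s2 <- r)
    (al r1 ⊗ ((r2 ∙ al s1) ⊗ be (s2 ∙ ps (ib y))))).
  have -> : \sw_(r1, r2 <- r) (\sw_(u, v <- Del y) (al r1 ⊗ ((r2 ∙ u) ⊗ be v)))
      = P3 - S - lam *: Q2.
    transitivity (
      \sw_(r1, r2 <- r) (\sw_(s1, s2 <- r)
         (al r1 ⊗ ((r2 ∙ (om (ia y) ∙ s1)) ⊗ be (be s2))))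
      - S - lam *: Q2).
      rewrite -swZ -!swN -!swD; apply: eq_sw => r1 r2.
      by rewrite sw_Del; [rewrite unitE | solve_bilin].
    congr (_ - _ - _).
    rewrite -[LHS]sw_al; last by solve_bilin.
    by do 2!apply: eq_sw => ? ?; rewrite /z /x /y !normE.
  have -> : \sw_(r1, r2 <- r) (\sw_(s1, s2 <- r)
      (al (al r1) ⊗ (al (r2 ∙ s1) ⊗ (be s2 ∙ ps y)))) = S.
    rewrite -[RHS]sw_al; last by solve_bilin.
    by do 2!apply: eq_sw => ? ?; rewrite !normE.
  rewrite -/P4 unitE.
  zmod_cancel.
(* In [Del one] both sums over [r] reduce to [r] itself, by invariance under [be] and [al], so only
   [- lam *: (one ⊗ one)] survives. *)
have R3 : \sw_(u, v <- Del one) (om (om a) ⊗ (u ⊗ v)) = - (lam *: Q3).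
  rewrite sw_Del; last by solve_bilin.
  have -> : ia one = one by apply: (can_inj alK); rewrite iaK unitE.
  have -> : ib one = one by apply: (can_inj beK); rewrite ibK unitE.
  rewrite !unitE.
  have -> : \sw_(r1, r2 <- r) (om (om a) ⊗ ((one ∙ r1) ⊗ be r2))
      = \sw_(r1, r2 <- r) (om (om a) ⊗ (r1 ⊗ r2)).
    by rewrite -[RHS]sw_be; [apply: eq_sw => r1 r2; rewrite unitE | solve_bilin].
  have -> : \sw_(r1, r2 <- r) (om (om a) ⊗ (al r1 ⊗ (r2 ∙ one)))
      = \sw_(r1, r2 <- r) (om (om a) ⊗ (r1 ⊗ r2)).
    by rewrite -[RHS]sw_al; [apply: eq_sw => r1 r2; rewrite unitE | solve_bilin].
  by rewrite subrr sub0r.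
rewrite [LHS]sw_Del; last by solve_bilin.
rewrite [RHS]sw_Del; last by solve_bilin.
rewrite L1 L2 L3 R1 R2 R3 scalerN !scalerBr.
zmod_cancel.
Qed.

Lemma Del_infBH_bialgebra : infBH_bialgebra lam mu Del al be ps om.
Proof.
split=> //; try by case: hA.
- split=> //; try by [exact: Del_linear | exact: linearP | exact: Del_coassoc].
  + by apply: Del_commute; case: hA.
  + by apply: Del_commute; case: hA.
- by apply: Del_commute; case: hA => // _ [].
- by apply: Del_commute; case: hA => // _ [].
- exact: Del_mul.
Qed.

(** * The coaction and the Hopf module axioms *)

Section HopfModule.
Variables (M : lmodType K) (gam : {linear (A ⊗ M)%type -> M}).
Variables (aM bM pM wM bMV : {linear M -> M}).
Local Notation "a ▹ m" := (gam (a ⊗ m)) (at level 40, left associativity).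
Hypothesis hM : left_module mu al be gam aM bM.
Hypotheses (bMK : cancel bM bMV) (bMVK : cancel bMV bM).
Hypothesis pM_gam : forall a m, pM (a ▹ m) = ps a ▹ pM m.
Hypothesis wM_gam : forall a m, wM (a ▹ m) = om a ▹ wM m.
Hypotheses (aM_pM : forall m, aM (pM m) = pM (aM m))
  (aM_wM : forall m, aM (wM m) = wM (aM m))
  (bM_pM : forall m, bM (pM m) = pM (bM m))
  (bM_wM : forall m, bM (wM m) = wM (bM m))
  (pM_wM : forall m, pM (wM m) = wM (pM m)).
Hypothesis unitM : lam <> 0 -> forall m, one ▹ m = bM m.

Let bM_gam := lm_be_gam hM : forall a m, bM (a ▹ m) = be a ▹ bM m.
Let actA := lm_assoc hM : forall a b m, al a ▹ (b ▹ m) = (a ∙ b) ▹ bM m.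
Let pM_bM := commute_sym bM_pM.
Let wM_bM := commute_sym bM_wM.
Let pM_bMV := commute_cancel bMK bMVK pM_bM.
Let wM_bMV := commute_cancel bMK bMVK wM_bM.
Let bMV_gam a m : bMV (a ▹ m) = ib a ▹ bMV m.
Proof. by apply: (can_inj bMK); rewrite bM_gam ibK !bMVK. Qed.
Let normM := (bM_gam, bMV_gam, pM_gam, wM_gam, bMK, bMVK, pM_bM, wM_bM,
  pM_bMV, wM_bMV, pM_wM).

(** [rho_r] with the inverse of [bM] as a bundled parameter, in parallel with [Del]. *)
Definition coact (m : M) : A ⊗ M :=
  - \sw_(r1, r2 <- r) (al r1 ⊗ (r2 ▹ pM (bMV m))).

Lemma coact_linear : linear coact.
Proof. by rewrite /coact; solve_linear. Qed.

HB.instance Definition _ := GRing.isLinear.Build K M (A ⊗ M)%type _ coact coact_linear.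

Lemma sw_coact (V : lmodType K) (F : A -> M -> V) m : bilin F ->
  \sw_(x, y <- coact m) (F x y)
  = - \sw_(r1, r2 <- r) (F (al r1) (r2 ▹ pM (bMV m))).
Proof.
move=> bF; rewrite /coact sw_opp // sw_sw //.
by congr (- _); apply: eq_sw => x y; rewrite sw_tens.
Qed.

Lemma coact_ps m : coact (pM m) = tmap ps pM (coact m).
Proof.
rewrite [RHS]sw_coact; last by solve_bilin.
rewrite /coact -sw_ps; last by solve_bilin.
by congr (- _); apply: eq_sw => r1 r2; rewrite !(normE, normM).
Qed.

Lemma coact_om m : coact (wM m) = tmap om wM (coact m).
Proof.
rewrite [RHS]sw_coact; last by solve_bilin.
rewrite /coact -sw_om; last by solve_bilin.
by congr (- _); apply: eq_sw => r1 r2; rewrite !(normE, normM).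
Qed.

Lemma coact_coassoc m :
  tassoc (tmap Del pM (coact m)) = tmap om coact (coact m).
Proof.
have -> : tassoc (tmap Del pM (coact m)) =
  \sw_(a1, m0 <- coact m) (\sw_(x, y <- Del a1) (x ⊗ (y ⊗ pM m0))).
  rewrite /tassoc /tmap sw_sw; last by solve_bilin.
  by apply: eq_sw => a1 m0; rewrite sw_tens //; solve_bilin.
rewrite [LHS]sw_coact; last by solve_bilin.
rewrite [RHS]sw_coact; last by solve_bilin.
congr (- _).
transitivity (\sw_(r1, r2 <- r) (\sw_(x, y <- Del r1)
    (al x ⊗ (al y ⊗ (ps r2 ▹ pM (pM (bMV m))))))).
  by apply: eq_sw => r1 r2; rewrite sw_Del_al; [rewrite !normM | solve_bilin].
rewrite (sw_r_Del_l (T := fun x y z => al x ⊗ (al y ⊗ (z ▹ pM (pM (bMV m))))));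
  last by solve_trilin.
(* [be] on the outer [r] cancels the [ib] coming from [bMV_gam]; [al] on the inner one then supplies
   the [al s2] required by [actA]. *)
rewrite -swN -[RHS]sw_be; last by solve_bilin.
apply: eq_sw => r1 r2.
rewrite tens_sw sw_coact; last by solve_bilin.
congr (- _); rewrite -[RHS]sw_al; last by solve_bilin.
by apply: eq_sw => s1 s2; rewrite !(normE, normM) actA !(normE, normM).
Qed.

(** The sum over [coact m] cancels the first term of [Del a], the unit term of [Del a] cancels the
    last summand, and the middle term of [Del a] is the coaction of [a ▹ m] by the module axiom. *)
Lemma coact_act a m :
  coact (a ▹ m) =
    (\sw_(a1, m0 <- coact m) ((om a ∙ a1) ⊗ bM m0))
    + (\sw_(a1, a2 <- Del a) (al a1 ⊗ (a2 ▹ pM m)))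
    + lam *: (al (om a) ⊗ bM (pM m)).
Proof.
rewrite [X in X + _ + _]sw_coact; last by solve_bilin.
rewrite [X in _ + X + _]sw_Del; last by solve_bilin.
(* [unitM] speaks only of nonzero [lam]; at [lam = 0] both sides vanish. *)
have -> : lam *: (al (om a) ⊗ (one ▹ pM m)) = lam *: (al (om a) ⊗ bM (pM m)).
  by have [-> | /eqP /unitM ->] := eqVneq lam 0; rewrite ?scale0r.
have -> : \sw_(r1, r2 <- r) (al (om (ia a) ∙ r1) ⊗ (be r2 ▹ pM m))
  = \sw_(r1, r2 <- r) ((om a ∙ al r1) ⊗ bM (r2 ▹ pM (bMV m))).
  by apply: eq_sw => r1 r2; rewrite !(normE, normM).
have -> : \sw_(r1, r2 <- r) (al (al r1) ⊗ ((r2 ∙ ps (ib a)) ▹ pM m)) = - coact (a ▹ m).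
  rewrite /coact opprK -[RHS]sw_al; last by solve_bilin.
  by apply: eq_sw => r1 r2; rewrite !(normE, normM) actA !(normE, normM).
(* [coact] unfolds to an opposite; generalizing makes it an atom for [zmod_cancel]. *)
move: (coact (a ▹ m)) => c; zmod_cancel.
Qed.

Lemma coact_Hopf_module :
  infBH_Hopf_module lam mu Del al be ps om gam coact aM bM pM wM.
Proof.
split=> //; first exact: Del_infBH_bialgebra.
- split=> //; try exact: linearP.
  + exact: coact_ps.
  + exact: coact_om.
  + exact: coact_coassoc.
- exact: coact_act.
Qed.

End HopfModule.
End Bialgebra.

(** * Transfer from bundled linear maps to plain functions *)

Unset Implicit Arguments.
Set Strict Implicit.

Theorem theorem3p12 (K : fieldType) (lam : K) (A M : lmodType K)
  (mu : A ⊗ A -> A) (one : A) (alA beA psA omA : A -> A)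
  (r : A ⊗ A)
  (gam : A ⊗ M -> M) (alM beM psM omM : M -> M)
  (hA : quasitriangular_infBH_bialgebra lam mu one alA beA psA omA r)
  (hM : left_module mu alA beA gam alM beM)
  (beM_bij : bijective beM)
  (psM_linear : linear psM) (omM_linear : linear omM)
  (beM_psM : forall m, beM (psM m) = psM (beM m))
  (psM_gam : forall t, psM (gam t) = gam (tmap psA psM t))
  (psA_omA : forall a, psA (omA a) = omA (psA a))
  (alM_psM : forall m, alM (psM m) = psM (alM m))
  (alM_omM : forall m, alM (omM m) = omM (alM m))
  (beM_omM : forall m, beM (omM m) = omM (beM m))
  (psM_omM : forall m, psM (omM m) = omM (psM m))
  (omM_gam : forall t, omM (gam t) = gam (tmap omA omM t))
  (unitM : lam <> 0 -> forall m, gam (one ⊗ m) = beM m) :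
  infBH_Hopf_module lam mu (Delta_r lam mu one alA beA psA omA r)
    alA beA psA omA gam (rho_r alA r gam beM psM) alM beM psM omM.
Proof.
have al_lin := bha_al_linear (qt_algebra hA).
have be_lin := bha_be_linear (qt_algebra hA).
(* The bundled maps are convertible to the original functions, so [Del] and [coact] built from them
   unfold to [Delta_r] and [rho_r], and the hypotheses can be passed unchanged. *)
pose L (U V : lmodType K) (f : U -> V) (hf : linear f) : {linear U -> V} :=
  HB.pack f (GRing.isLinear.Build _ _ _ _ _ hf).
have alK := linvKV (qt_al_bij hA); have alVK := linvK (qt_al_bij hA).
have beK := linvKV (qt_be_bij hA); have beVK := linvK (qt_be_bij hA).
pose mu' := L _ _ _ (bha_mu_linear (qt_algebra hA)).
pose al' := L _ _ _ al_lin.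
pose be' := L _ _ _ be_lin.
pose ps' := L _ _ _ (qt_ps_linear hA).
pose om' := L _ _ _ (qt_om_linear hA).
pose ia' := L _ _ _ (linear_linv (f := al') (qt_al_bij hA)).
pose ib' := L _ _ _ (linear_linv (f := be') (qt_be_bij hA)).
pose gam' := L _ _ _ (lm_gam_linear hM).
pose aM' := L _ _ _ (lm_al_linear hM).
pose bM' := L _ _ _ (lm_be_linear hM).
pose pM' := L _ _ _ psM_linear.
pose wM' := L _ _ _ omM_linear.
pose bMV' := L _ _ _ (linear_linv (f := bM') beM_bij).
apply: (@coact_Hopf_module K lam A mu' one al' be' ps' om' ia' ib' r
  hA psA_omA alK alVK beK beVK M gam' aM' bM' pM' wM' bMV' hM) => //.
- exact: linvKV.
- exact: linvK.
- by move=> a m; rewrite [LHS]psM_gam [tmap _ _ _](tmap_tens ps' pM').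
- by move=> a m; rewrite [LHS]omM_gam [tmap _ _ _](tmap_tens om' wM').
Qed.
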